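(* Let $F:\mathbb C^3\to\mathbb C$, $(a_0,a_1,x)\mapsto x^2 + a_1 x + a_0$. Then there is no continuous function $r:\mathbb C^2\to\mathbb C$ such that $F(M,r(M))=0$ for all $M=(a_0,a_1)\in\mathbb C^2$.
   Context: Here $F(M,x)$ with $M=(a_0,a_1)$ means $F(a_0,a_1,x)$. Continuity is with respect to the standard topologies of $\mathbb C^2$ and $\mathbb C$. *)

(* Defs.v *)
From Stdlib Require Import Reals.
From Coquelicot Require Import Coquelicot.

Local Open Scope C_scope.

(* [C * C * C] parses as [(C * C) * C], so for [M : C * C] the term
   [F (M, x)] is literally [F (a0, a1, x)] when [M = (a0, a1)]. *)
Definition F (p : C * C * C) : C :=
  let '(a0, a1, x) := p in x ^ 2 + a1 * x + a0.

(* Main.v *)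
Require Import Defs.
From Stdlib Require Import Reals Lra.
From Coquelicot Require Import Coquelicot.

(** Along the loop [a1 = 0], [a0 = - e^(it)], the root [s] satisfies
    [s ^ 2 = e^(it)], so [s(t) e^(-it/2)] is a square root of [1] and its real
    part never vanishes; but that real part is continuous and changes sign
    between [t = 0] and [t = 2 PI], because [s] takes the same value at both
    ends whereas [e^(it/2)] changes sign. *)

Local Open Scope R_scope.

(** A ball of the product is a product of balls of the same radius, so the two neighbourhood
    conditions intersect. *)
Lemma continuous_pair {U V W : UniformSpace} (f : U -> V) (g : U -> W) (x : U) :
  continuous f x -> continuous g x ->
  continuous (U := prod_UniformSpace V W) (fun u => (f u, g u)) x.
Proof.
intros Hf Hg; apply filterlim_locally; intros eps.
exact (filter_and _ _ (proj1 (filterlim_locally _ _) Hf eps)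
                      (proj1 (filterlim_locally _ _) Hg eps)).
Qed.

Definition coef_loop (t : R) : C * C := ((- cos t, - sin t), (0, 0)).

Lemma continuous_coef_loop (t : R) :
  continuous (U := prod_UniformSpace C_UniformSpace C_UniformSpace) coef_loop t.
Proof.
apply (continuous_pair (V := C_UniformSpace) (W := C_UniformSpace)).
- apply (continuous_pair (fun t => - cos t) (fun t => - sin t)).
  + apply (ex_derive_continuous (fun t => - cos t)); auto_derive; trivial.
  + apply (ex_derive_continuous (fun t => - sin t)); auto_derive; trivial.
- apply continuous_const.
Qed.

Lemma coef_loop_2PI : coef_loop (2 * PI) = coef_loop 0.
Proof. unfold coef_loop; now rewrite cos_2PI, sin_2PI, cos_0, sin_0. Qed.

Lemma F_coef_loop_eq0 (t : R) (z : C) :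
  F (coef_loop t, z) = RtoC 0 ->
  fst z ^ 2 - snd z ^ 2 = cos t /\ 2 * fst z * snd z = sin t.
Proof.
destruct z as [a b]; unfold F, coef_loop; simpl; intros H.
apply (f_equal fst) in H as Hre; apply (f_equal snd) in H as Him.
simpl in Hre, Him; split; simpl; lra.
Qed.

(** The expression is the real part of [u = (a + ib) e^(-it/2)]. Since [u ^ 2 = 1], a vanishing real
    part would give [- (Im u) ^ 2 = 1]. *)
Lemma half_angle_Re_neq0 (t a b : R) :
  a ^ 2 - b ^ 2 = cos t -> 2 * a * b = sin t ->
  a * cos (t / 2) + b * sin (t / 2) <> 0.
Proof.
intros Hre Him H0.
replace t with (2 * (t / 2)) in Hre, Him by field.
rewrite cos_2a in Hre; rewrite sin_2a in Him.
pose proof (sin2_cos2 (t / 2)) as H1; unfold Rsqr in H1.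
set (c := cos (t / 2)) in *; set (d := sin (t / 2)) in *.
(* [Re u ^ 2 - Im u ^ 2 = Re (u ^ 2) = 1] for [u = (a + ib)(c - id)] *)
assert (E : (a * c + b * d) ^ 2 - (b * c - a * d) ^ 2 = 1).
(* The middle term is the real part of [(a + ib) ^ 2] times the conjugate of [(c + id) ^ 2]. *)
{ transitivity ((a ^ 2 - b ^ 2) * (c * c - d * d) + (2 * a * b) * (2 * d * c)).
  - ring.
  - rewrite Hre, Him.
    transitivity ((d * d + c * c) ^ 2); [ring | rewrite H1; ring]. }
rewrite H0 in E; nra.
Qed.

Theorem mainTheorem3 :
  ~ exists r : C * C -> C,
      (forall M : C * C, continuous r M) /\
      (forall M : C * C, F (M, r M) = RtoC 0).
Proof.
intros [r [Hcont Hroot]].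
set (h := fun t => fst (r (coef_loop t)) * cos (t / 2)
                   + snd (r (coef_loop t)) * sin (t / 2)).
assert (Hr : forall t, continuous (fun t => r (coef_loop t)) t).
{ intros t; apply continuous_comp; [apply continuous_coef_loop | apply Hcont]. }
assert (Hh : continuity h).
{ intros t; apply continuity_pt_filterlim.
  apply (continuous_plus (V := R_NormedModule)
           (fun t => fst (r (coef_loop t)) * cos (t / 2))
           (fun t => snd (r (coef_loop t)) * sin (t / 2)));
    apply (continuous_mult (K := R_AbsRing)).
  - apply (continuous_comp (fun t => r (coef_loop t)) fst); [apply Hr|].
    (* [continuous_fst] is stated at an explicit pair. *)
    destruct (r (coef_loop t)); apply continuous_fst.
  - apply (ex_derive_continuous (fun t => cos (t / 2))); auto_derive; trivial.
  - apply (continuous_comp (fun t => r (coef_loop t)) snd); [apply Hr|].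
    destruct (r (coef_loop t)); apply continuous_snd.
  - apply (ex_derive_continuous (fun t => sin (t / 2))); auto_derive; trivial. }
assert (Hends : h (2 * PI) = - h 0).
{ unfold h; rewrite coef_loop_2PI.
  replace (2 * PI / 2) with PI by field; replace (0 / 2) with 0 by field.
  rewrite cos_PI, sin_PI, cos_0, sin_0; ring. }
destruct (IVT_gen h 0 (2 * PI) 0 Hh) as [t [_ Ht]].
(* The sign of [h 0] is unknown, but 0 always lies between [h 0] and [- h 0]. *)
{ rewrite Hends; unfold Rmin, Rmax; destruct (Rle_dec (h 0) (- h 0)); lra. }
destruct (F_coef_loop_eq0 t _ (Hroot (coef_loop t))) as [Hre Him].
exact (half_angle_Re_neq0 t _ _ Hre Him Ht).
Qed.
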